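(* Let $T'$ be a $\mathcal{T}_7$-free tournament and let $z$ be any vertex of $T'$. Then: (a) the subtournament induced by $V_3(z)$ is $\mathcal{T}_5$-free, and $V_3(z)$ is 2-in-dominated by $V_2(z)$; (b) the subtournament induced by $V_4(z)$ is $\mathcal{T}_5$-free, and $V_4(z)$ is 2-in-dominated by $V_3(z)$; (c) if $z$ is a vertex of minimum in-degree in $T'$, then the subtournament induced by $V_2(z)$ is also $\mathcal{T}_5$-free.
   Context: A tournament is an orientation of a complete graph; $u\to v$ denotes the arc from $u$ to $v$. $\mathcal{T}_5$ is the family of $5$-vertex tournaments with no transitive subtournament on $4$ vertices; $\mathcal{T}_7$ is the family of $7$-vertex tournaments with no transitive subtournament on $5$ vertices; a tournament is $\mathcal{T}_k$-free ($k=5,7$) if it has no $k$-vertex subtournament isomorphic to a member of $\mathcal{T}_k$. For a vertex $z$ and $\ell\ge1$, $V_\ell(z)$ is the set of vertices $v$ such that the shortest directed path from $v$ to $z$ has length exactly $\ell-1$ (so $V_1(z)=\{z\}$ and $V_2(z)=\{v: v\to z\}$). For disjoint vertex sets $S,Z$, $Z$ in-dominates $S$ if for every $s\in S$ there is $z'\in Z$ with $s\to z'$; $Z$ 2-in-dominates $S$ if some $Z'\subseteq Z$ with $|Z'|\le 2$ in-dominates $S$. *)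

(* Defs.v *)
From mathcomp Require Import all_boot.
Set Implicit Arguments.
Unset Strict Implicit.
Unset Printing Implicit Defensive.

Record tournament := Tournament {
  vertex :> finType;
  arc : rel vertex;
  arc_irr : irreflexive arc;
  arc_tot : forall x y, x != y -> arc x y (+) arc y x
}.
Arguments arc {t} : rename.

Section Induced.
Variables (G : tournament) (S : {set G}).

Definition sub_arc : rel {x : G | x \in S} := fun x y => arc (val x) (val y).

Fact sub_arc_irr : irreflexive sub_arc.
Proof. by move=> x; apply: arc_irr. Qed.

Fact sub_arc_tot x y : x != y -> sub_arc x y (+) sub_arc y x.
Proof. by move=> neq_xy; apply: arc_tot; rewrite val_eqE. Qed.

Definition induced : tournament := Tournament sub_arc_irr sub_arc_tot.

End Induced.

Definition iso (G H : tournament) : Prop :=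
  exists2 f : G -> H, bijective f & forall x y, arc (f x) (f y) = arc x y.

Definition is_transitive (G : tournament) : Prop := transitive (@arc G).

Definition in_family (n k : nat) (H : tournament) : Prop :=
  #|H| = n /\ ~ exists S : {set H}, #|S| = k /\ is_transitive (induced S).

Definition family_free (F : tournament -> Prop) (G : tournament) : Prop :=
  forall (S : {set G}) (H : tournament), F H -> ~ iso (induced S) H.

Definition T5 : tournament -> Prop := in_family 5 4.
Definition T7 : tournament -> Prop := in_family 7 5.
Definition T5_free : tournament -> Prop := family_free T5.
Definition T7_free : tournament -> Prop := family_free T7.

(* n counts arcs, i.e. p lists the vertices after v. *)
Definition has_dipath (G : tournament) (v z : G) (n : nat) : bool :=
  [exists p : n.-tuple G,
    [&& path arc v p, last v p == z & uniq (v :: p)]].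

(* V_l(z), for l >= 1: layer 0 is junk and equals layer 1. *)
Definition layer (G : tournament) (l : nat) (z : G) : {set G} :=
  [set v | has_dipath v z l.-1 & [forall m : 'I_l.-1, ~~ has_dipath v z m]].

Definition in_dominates (G : tournament) (Z S : {set G}) : Prop :=
  forall s, s \in S -> exists2 z, z \in Z & arc s z.

Definition two_in_dominates (G : tournament) (Z S : {set G}) : Prop :=
  exists Z' : {set G}, [/\ Z' \subset Z, #|Z'| <= 2 & in_dominates Z' S].

Definition in_degree (G : tournament) (v : G) : nat := #|[set u : G | arc u v]|.

(* Main.v *)
From mathcomp Require Import all_boot.
Require Import Defs.

(** Reformulate freeness as: every n-set contains a transitive k-set.

    A bad 5-set S (no transitive 4-subset) cannot be 2-in-dominated by vertices
    v each having some w with v -> w -> S: a transitive 5-subset of S + v + w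
    consists of v, w and three vertices of S dominated by v, so v has at most two
    in-neighbours in S, and two such v leave a vertex of S undominated.  This
    gives the T5-freeness in (a) and (b).  In (c), minimality of the in-degree
    of z says that N^+(z) out-dominates N^-(z), so the same argument applies to
    the reversed tournament.

    For the 2-in-domination, a minimal in-dominating set with three elements
    v1, v2, v3 has private vertices s1, s2, s3, with s_i -> v_i and v_j -> s_i
    for j <> i.  A vertex w with v_i -> w -> s_i for all i then gives 7 vertices
    without transitive 5-subset.  In (a) take w = z.  In (b) the three v_i need
    not have a common out-neighbour in V_2, but they are in-dominated by two
    vertices w, x of V_2, and 7-subsets of {z, w, x, v_i, s_i} suffice. *)

Set Implicit Arguments.
Unset Strict Implicit.
Unset Printing Implicit Defensive.

(** * Transitive vertex sets and short directed cycles *)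

Section Arcs.
Variable G : tournament.
Implicit Types (x y z : G) (S X Z : {set G}).

Lemma arc_neq x y : arc x y -> x != y.
Proof. by apply: contraTneq => ->; rewrite arc_irr. Qed.

Lemma arc_asym x y : arc x y -> arc y x = false.
Proof. by move=> xy; have := arc_tot (arc_neq xy); rewrite xy /=; case: arc. Qed.

Lemma arcNarc x y : x != y -> ~~ arc x y -> arc y x.
Proof. by move/arc_tot; case: arc. Qed.

(** A boolean predicate on subsets of [G] itself, so that sets can be shrunk and intersected without
    passing through the subtype of [induced X]. *)
Definition transitive_on (X : {set G}) : bool :=
  [forall x in X, forall y in X, forall z in X,
     arc x y ==> arc y z ==> arc x z].

Lemma transitive_onP X :
  reflect (forall x y z, x \in X -> y \in X -> z \in X ->
             arc x y -> arc y z -> arc x z) (transitive_on X).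
Proof.
apply: (iffP forall_inP) => [tX x y z xX yX zX xy yz | tX x xX].
  have /forall_inP/(_ y yX)/forall_inP/(_ z zX) := tX x xX.
  by rewrite xy yz.
apply/forall_inP => y yX; apply/forall_inP => z zX.
by apply/implyP => xy; apply/implyP; apply: tX xy.
Qed.

Lemma transitive_onS X Z : X \subset Z -> transitive_on Z -> transitive_on X.
Proof.
move=> /subsetP sXZ /transitive_onP tZ; apply/transitive_onP => x y z xX yX zX.
by apply: tZ; apply: sXZ.
Qed.

Lemma transitive_on_induced X : is_transitive (induced X) <-> transitive_on X.
Proof.
split=> [tX | /transitive_onP tX y x z]; last first.
  by apply: tX; apply: valP.
apply/transitive_onP => x y z xX yX zX.
exact: (tX (Sub y yX) (Sub x xX) (Sub z zX)).
Qed.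

Lemma transitive_on_no3cycle X x y z : transitive_on X ->
  arc x y -> arc y z -> arc z x -> ~~ [&& x \in X, y \in X & z \in X].
Proof.
move=> /transitive_onP tX xy yz zx; apply/negP => /and3P[xX yX zX].
by have := tX _ _ _ xX yX zX xy yz; rewrite (arc_asym zx).
Qed.

(** Transitivity yields [x -> z] and then [x -> t], against [t -> x]; the two diagonals may have any
    orientation. *)
Lemma transitive_on_no4cycle X x y z t : transitive_on X ->
  arc x y -> arc y z -> arc z t -> arc t x ->
  ~~ [&& x \in X, y \in X, z \in X & t \in X].
Proof.
move=> /transitive_onP tX xy yz zt tx; apply/negP => /and4P[xX yX zX tX'].
have xz := tX _ _ _ xX yX zX xy yz.
by have := tX _ _ _ xX zX tX' xz zt; rewrite (arc_asym tx).
Qed.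

Definition has_transitive_subset (k : nat) (S : {set G}) : bool :=
  [exists X : {set G}, [&& X \subset S, #|X| == k & transitive_on X]].

Lemma has_transitive_subsetP k S :
  reflect (exists X, [/\ X \subset S, #|X| = k & transitive_on X])
          (has_transitive_subset k S).
Proof.
apply: (iffP existsP) => -[X].
  by case/and3P=> sXS /eqP cX tX; exists X.
by case=> sXS /eqP cX tX; exists X; apply/and3P.
Qed.

Lemma subset_of_card k S : k <= #|S| -> exists2 X : {set G}, X \subset S & #|X| = k.
Proof.
rewrite cardE => le_k; exists [set x in take k (enum S)].
  by apply/subsetP => x; rewrite inE => /mem_take; rewrite mem_enum.
by rewrite cardsE (card_uniqP _) ?take_uniq ?enum_uniq // size_takel.
Qed.

Lemma has_transitive_subset_le k S X :
  X \subset S -> transitive_on X -> k <= #|X| -> has_transitive_subset k S.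
Proof.
move=> sXS tX /subset_of_card[Y sYX cY]; apply/has_transitive_subsetP.
by exists Y; split; [apply: subset_trans sXS | | apply: transitive_onS tX].
Qed.

End Arcs.

(** * Freeness in terms of transitive subsets *)

Lemma transitive_on_imset (G H : tournament) (f : G -> H) (X : {set G}) :
  (forall x y, arc (f x) (f y) = arc x y) ->
  transitive_on (f @: X) = transitive_on X.
Proof.
move=> fE; apply/transitive_onP/transitive_onP => [tX x y z xX yX zX | tX x' y' z'].
  by move: (tX (f x) (f y) (f z)); rewrite !fE; apply; apply: imset_f.
case/imsetP=> x xX -> /imsetP[y yX ->] /imsetP[z zX ->].
by rewrite !fE; apply: tX.
Qed.

Lemma card_induced (G : tournament) (S : {set G}) : #|induced S| = #|S|.
Proof. by rewrite card_sig; apply: eq_card => x; rewrite inE. Qed.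

Definition trans_dense (n k : nat) (G : tournament) : Prop :=
  forall S : {set G}, #|S| = n -> has_transitive_subset k S.

(** If an [n]-set [S] has no transitive [k]-subset, then [induced S] is itself a member of the
    family. Conversely, an isomorphism carries a transitive [k]-subset of [S] over to [H]. *)
Lemma family_freeP (n k : nat) (G : tournament) :
  family_free (in_family n k) G <-> trans_dense n k G.
Proof.
split=> [free S cS | dense S H [cH noX] [f bij_f fE]].
  have [//|noX] := has_transitive_subsetP k S; case: (free S (induced S)).
    split=> [|[X [cX /transitive_on_induced tX]]]; first by rewrite card_induced.
    apply: noX; exists (val @: X); split.
    - by apply/subsetP => _ /imsetP[x _ ->]; apply: valP.
    - by rewrite (card_imset _ val_inj).
    - by rewrite (@transitive_on_imset (induced S) G val).
  by exists id => //; exists id.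
have cS : #|S| = n by rewrite -cH -card_induced; apply: bij_eq_card bij_f.
have /has_transitive_subsetP[X [/subsetP sXS cX tX]] := dense S cS.
pose Y : {set induced S} := [set x | val x \in X].
have valY : val @: Y = X.
  apply/setP => x; apply/imsetP/idP => [[y] | xX]; first by rewrite inE => yX ->.
  by exists (Sub x (sXS x xX)); rewrite ?inE.
apply: noX; exists (f @: Y); split.
  rewrite (card_imset _ (bij_inj bij_f)) -cX -valY.
  by rewrite (card_imset _ val_inj).
apply/transitive_on_induced; rewrite transitive_on_imset //.
by rewrite -(@transitive_on_imset (induced S) G val) ?valY.
Qed.

Lemma trans_dense_induced (n k : nat) (G : tournament) (L : {set G}) :
  (forall S : {set G}, S \subset L -> #|S| = n -> has_transitive_subset k S) ->
  trans_dense n k (induced L).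
Proof.
move=> dense S cS; have cS' : #|val @: S| = n.
  by rewrite (card_imset _ val_inj).
have [|X [sXS cX tX]] := has_transitive_subsetP _ _ (dense _ _ cS').
  by apply/subsetP => _ /imsetP[x _ ->]; apply: valP.
pose Y : {set induced L} := [set x | val x \in X].
have valY : val @: Y = X.
  apply/setP => x; apply/imsetP/idP => [[y] | xX]; first by rewrite inE => yX ->.
  by have /imsetP[y _ xE] := subsetP sXS x xX; exists y; rewrite // inE -xE.
apply/has_transitive_subsetP; exists Y; split.
- apply/subsetP => y; rewrite inE => /(subsetP sXS)/imsetP[y' y'S].
  by move/val_inj->.
- by rewrite -cX -valY (card_imset _ val_inj).
- by rewrite -(@transitive_on_imset (induced L) G val) ?valY.
Qed.

(** * Reversal of all arcs *)

Section Reverse.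
Variable G : tournament.

Definition rev_arc : rel G := fun x y => arc y x.

Fact rev_arc_irr : irreflexive rev_arc.
Proof. exact: arc_irr. Qed.

Fact rev_arc_tot x y : x != y -> rev_arc x y (+) rev_arc y x.
Proof. by move=> xy; rewrite addbC; apply: arc_tot. Qed.

Definition reverse : tournament := Tournament rev_arc_irr rev_arc_tot.

Lemma transitive_on_reverse (X : {set G}) :
  transitive_on (X : {set reverse}) = transitive_on X.
Proof.
by apply/transitive_onP/transitive_onP => tX x y z xX yX zX xy yz;
  apply: (tX z y x).
Qed.

Lemma has_transitive_subset_reverse (k : nat) (S : {set G}) :
  has_transitive_subset k (S : {set reverse}) = has_transitive_subset k S.
Proof. by apply: eq_existsb => X; rewrite transitive_on_reverse. Qed.

Lemma trans_dense_reverse (n k : nat) : trans_dense n k G -> trans_dense n k reverse.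
Proof. by move=> dense S cS; rewrite has_transitive_subset_reverse; apply: dense. Qed.

End Reverse.

(** * Small in-dominating sets and private vertices *)

Lemma two_in_dominatesP (G : tournament) (Z S : {set G}) (s0 : G) :
  s0 \in S -> two_in_dominates Z S ->
  exists w x, [/\ w \in Z, x \in Z & forall s, s \in S -> arc s w || arc s x].
Proof.
move=> s0S [Z' [sZ' cZ' dom]]; have [w wZ' _] := dom s0 s0S.
(* The dominator [w] of [s0] shows that [Z'] is nonempty; if [Z'] is the singleton of [w], then [x]
   is [w] again. *)
have [x xZ' sub] : exists2 x, x \in Z' & Z' \subset [set w; x].
  have [Z'w0 | [x]] := set_0Vmem (Z' :\ w).
    exists w => //; apply/subsetP => y yZ'; rewrite !inE orbb.
    by move/setP/(_ y): Z'w0; rewrite !inE yZ' andbT => /negbFE.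
  rewrite !inE => /andP[xw xZ']; exists x => //.
  have: [set w; x] == Z'.
    by rewrite eqEcard subUset !sub1set wZ' xZ' cards2 eq_sym xw.
  by move/eqP->.
exists w, x; split; rewrite ?(subsetP sZ') // => s /dom[y /(subsetP sub)].
by rewrite !inE => /orP[] /eqP-> ->; rewrite ?orbT.
Qed.

(** The orientations inside [v1, v2, v3] and inside [s1, s2, s3] are left open. *)
Definition private_pattern (G : tournament) (v1 v2 v3 s1 s2 s3 : G) : Prop :=
  [/\ [/\ arc s1 v1, arc s2 v2 & arc s3 v3], [/\ arc v1 s2 & arc v1 s3],
      [/\ arc v2 s1 & arc v2 s3] & [/\ arc v3 s1 & arc v3 s2]].

Lemma two_in_dominates_or_private (G : tournament) (Z S : {set G}) :
  [disjoint Z & S] -> in_dominates Z S ->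
  two_in_dominates Z S \/
  exists v1 v2 v3 s1 s2 s3, [/\ [/\ v1 \in Z, v2 \in Z & v3 \in Z],
    [/\ s1 \in S, s2 \in S & s3 \in S] & private_pattern v1 v2 v3 s1 s2 s3].
Proof.
move=> disZS dom.
pose domb (Y : {set G}) := [forall s in S, exists y in Y, arc s y].
have dombP Y : reflect (in_dominates Y S) (domb Y).
  apply: (iffP forall_inP) => domY s sS; first exact/exists_inP/domY.
  exact/exists_inP/domY.
have [Z' /minsetP[/dombP domZ' minZ'] sZ'] := minset_exists (introT (dombP Z) dom).
have [cZ' | ] := leqP #|Z'| 2; first by left; exists Z'.
rewrite cardE => cZ'; right.
have private v : v \in Z' -> exists s,
    [/\ s \in S, arc s v & forall u, u \in Z' -> u != v -> arc u s].
  (* By minimality, removing [v] leaves some [s] undominated; this [s] is private to [v]. *)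
  move=> vZ'; have : ~~ domb (Z' :\ v).
    apply/negP => /minZ' /(_ (subsetDl _ _)) /setP/(_ v).
    by rewrite !inE eqxx vZ'.
  rewrite negb_forall_in => /exists_inP[s sS]; rewrite negb_exists_in.
  move=> /forall_inP Nd; have Nsu u : u \in Z' -> u != v -> ~~ arc s u.
    by move=> uZ' uv; apply: Nd; rewrite !inE uv.
  exists s; split=> // [|u uZ' uv].
    have [u uZ' su] := domZ' s sS; have [<- // | uv] := eqVneq u v.
    by have := Nsu u uZ' uv; rewrite su.
  (* Reversing a missing arc requires distinct ends: [s] lies in [S] and [u] in [Z], which are
     disjoint. *)
  apply: arcNarc (Nsu u uZ' uv); apply: contraTneq sS => ->.
  by rewrite (disjointFr disZS) // (subsetP sZ').
have [v1 [v2 [v3 [v1Z v2Z v3Z v12 [v13 v23]]]]] : exists v1 v2 v3,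
    [/\ v1 \in Z', v2 \in Z', v3 \in Z', v1 != v2 & v1 != v3 /\ v2 != v3].
  have memZ' : enum Z' =i Z' by move=> v; rewrite mem_enum.
  have := enum_uniq Z'; move: cZ' memZ'; case: (enum _) => [|v1 [|v2 [|v3 l]]] //= _.
  move=> memZ' /and3P[]; rewrite !inE !negb_or => /and3P[v12 v13 _] /andP[v23 _] _.
  by exists v1, v2, v3; rewrite -!memZ' !inE !eqxx !orbT; split.
have [s1 [s1S sv1 p1]] := private v1 v1Z.
have [s2 [s2S sv2 p2]] := private v2 v2Z.
have [s3 [s3S sv3 p3]] := private v3 v3Z.
exists v1, v2, v3, s1, s2, s3; split; first by rewrite !(subsetP sZ').
  by split.
by split; split=> //; [apply: p2 | apply: p3 | apply: p1 | apply: p3 | apply: p1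
  | apply: p2] => //; rewrite // eq_sym.
Qed.

(** * Sets of five vertices without a transitive 4-subset *)

Lemma card_in_neighbours_le2 (G : tournament) (S : {set G}) (v w : G) :
  trans_dense 7 5 G -> #|S| = 5 -> ~~ has_transitive_subset 4 S ->
  arc v w -> (forall s, s \in S -> arc w s) -> #|[set s in S | arc s v]| <= 2.
Proof.
move=> dense cS bad vw wS.
have wNS : w \notin S by apply/negP => /wS; rewrite arc_irr.
have vNS : v \notin S by apply/negP => /wS; rewrite (arc_asym vw).
have cS7 : #|w |: (v |: S)| = 7.
  by rewrite !cardsU1 !inE (negPf wNS) (negPf vNS) cS orbF eq_sym (arc_neq vw).
have /has_transitive_subsetP[X [sX cX tX]] := dense _ cS7.
pose Y := X :&: S.
have cY : #|Y| <= 3.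
  rewrite leqNgt; apply: contra bad => cY.
  apply: has_transitive_subset_le cY; first exact: subsetIr.
  exact: transitive_onS (subsetIl _ _) tX.
have sXY : X :\ w :\ v \subset Y.
  apply/subsetP => x; rewrite !inE => /and3P[xv xw xX]; rewrite xX.
  by have := subsetP sX x xX; rewrite !inE (negPf xv) (negPf xw).
have := subset_leq_card sXY; have := cardsD1 v (X :\ w); have := cardsD1 w X.
rewrite cX !inE => eqw eqv leY.
(* The five vertices of [X] include at most three of [S], so both [v] and [w] occur and exactly
   three lie in [S]. *)
have [wX vX cY3] : [/\ w \in X, v \in X & 3 <= #|Y|].
  move: eqw leY (leq_trans leY cY); rewrite eqv (arc_neq vw) /=.
  by case: (w \in X); case: (v \in X); rewrite ?add0n ?add1n => -[<-].
(* An in-neighbour [s] of [v] in [Y] would close the cycle [v -> w -> s -> v] inside [X], so all of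
   them are among the two vertices outside [Y]. *)
have sN : [set s in S | arc s v] \subset S :\: Y.
  apply/subsetP => s; rewrite !inE => /andP[sS sv]; rewrite sS andbT andbT.
  apply/negP => sX'; move/transitive_onP/(_ _ _ _ vX wX sX' vw (wS s sS)): tX.
  by rewrite (arc_asym sv).
apply: leq_trans (subset_leq_card sN) _.
have -> : #|S :\: Y| = 5 - #|Y|.
  by rewrite -cS -(cardsID Y S) (setIidPr (subsetIr _ _)) addKn.
by rewrite leq_subLR addnC (leq_add2l 2 3).
Qed.

Lemma two_in_dominated_T5_free (G : tournament) (V S : {set G}) :
  trans_dense 7 5 G -> two_in_dominates V S ->
  (forall v, v \in V -> exists2 w, arc v w & forall s, s \in S -> arc w s) ->
  forall S5 : {set G}, S5 \subset S -> #|S5| = 5 -> has_transitive_subset 4 S5.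
Proof.
move=> dense dom rel S5 /subsetP sS5 cS5; apply: contraT => bad.
have /card_gt0P[s0 s0S] : 0 < #|S5| by rewrite cS5.
have [u [v [uV vV domS]]] := two_in_dominatesP (sS5 _ s0S) dom.
have le2 t : t \in V -> #|[set s in S5 | arc s t]| <= 2.
  case/rel=> w tw wS; apply: (card_in_neighbours_le2 dense cS5 bad tw) => s /sS5.
  exact: wS.
(* The two dominators have at most two in-neighbours each in [S5]. *)
suff : #|S5| <= 4 by rewrite cS5.
apply: leq_trans (leq_add (le2 u uV) (le2 v vV)).
apply: leq_trans (leq_card_setU _ _); apply/subset_leq_card/subsetP => s sS.
by rewrite !inE sS /=; apply: domS; apply: sS5.
Qed.

(** * Excluded configurations on seven vertices *)

Section FiniteConfigurations.
Variables (G : tournament) (dense : trans_dense 7 5 G).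

(** Counting along an explicit list lets a case split on the seven memberships compute the size. *)
Lemma transitive5_of_seq7 (l : seq G) : uniq l -> size l = 7 ->
  exists2 X : {set G}, transitive_on X & count (mem X) l = 5.
Proof.
move=> Ul sl; have cl : #|[set x in l]| = 7 by rewrite cardsE (card_uniqP Ul).
have /has_transitive_subsetP[X [/subsetP sX cX tX]] := dense cl.
exists X; rewrite // -size_filter -cX -(card_uniqP (filter_uniq _ Ul)).
apply: eq_card => x; rewrite mem_filter /= andb_idr // => /sX.
by rewrite inE.
Qed.

(** Two full pairs [{v_i, s_i}] span a 4-cycle, and one full pair with [w] is a 3-cycle. So a
    transitive set without [w] contains at most one full pair, and one with [w] contains none;
    either way it has at most four vertices. *)
Lemma no_common_out_neighbour (w v1 v2 v3 s1 s2 s3 : G) :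
  private_pattern v1 v2 v3 s1 s2 s3 ->
  arc v1 w -> arc v2 w -> arc v3 w -> arc w s1 -> arc w s2 -> arc w s3 -> False.
Proof.
case=> [[sv1 sv2 sv3] [vs12 vs13] [vs21 vs23] [vs31 vs32]] vw1 vw2 vw3 ws1 ws2 ws3.
have neq_dist (a b c : G) : arc a c -> ~~ arc b c -> a != b.
  by move=> ac; apply: contraNneq => <-.
have Ul : uniq [:: w; v1; v2; v3; s1; s2; s3].
  have v12 : v1 != v2 by rewrite eq_sym (neq_dist _ _ s1) ?(arc_asym sv1).
  have v13 : v1 != v3 by rewrite eq_sym (neq_dist _ _ s1) ?(arc_asym sv1).
  have v23 : v2 != v3 by rewrite eq_sym (neq_dist _ _ s2) ?(arc_asym sv2).
  have s12 : s1 != s2 by rewrite (neq_dist _ _ v1) ?(arc_asym vs12).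
  have s13 : s1 != s3 by rewrite (neq_dist _ _ v1) ?(arc_asym vs13).
  have s23 : s2 != s3 by rewrite (neq_dist _ _ v2) ?(arc_asym vs23).
  rewrite /= !inE !negb_or v12 v13 v23 s12 s13 s23.
  rewrite ![w == v1]eq_sym ![w == v2]eq_sym ![w == v3]eq_sym.
  rewrite [v1 == s1]eq_sym [v2 == s2]eq_sym [v3 == s3]eq_sym.
  by rewrite !arc_neq.
have [X tX] := transitive5_of_seq7 Ul erefl.
have := transitive_on_no4cycle tX sv1 vs12 sv2 vs21.
have := transitive_on_no4cycle tX sv1 vs13 sv3 vs31.
have := transitive_on_no4cycle tX sv2 vs23 sv3 vs32.
have := transitive_on_no3cycle tX sv1 vw1 ws1.
have := transitive_on_no3cycle tX sv2 vw2 ws2.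
have := transitive_on_no3cycle tX sv3 vw3 ws3.
rewrite /=; case: (w \in X); case: (v1 \in X); case: (v2 \in X); case: (v3 \in X);
by case: (s1 \in X); case: (s2 \in X); case: (s3 \in X).
Qed.

(* The vertex s of this configuration is the private vertex of v1. *)
Definition split_pattern (z w x v1 v2 v3 s : G) : Prop :=
  [/\ [/\ arc w z, arc x z & arc z s], [/\ arc z v1, arc z v2 & arc z v3],
      [/\ arc v1 w, arc v2 w, arc w v3 & arc v3 x], arc w s /\ arc x s
    & [/\ arc s v1, arc v2 s & arc v3 s]].

(** The pattern orients 15 of the 21 pairs. In each of the other six, [{w, x}], [{x, v1}], [{x, v2}]
    and the pairs of [v_i], a directed path of length two joins the vertices, so they are
    distinct. *)
Lemma split_pattern_transitive5 (z w x v1 v2 v3 s : G) :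
  split_pattern z w x v1 v2 v3 s ->
  exists2 X : {set G}, transitive_on X &
    count (mem X) [:: z; w; x; v1; v2; v3; s] = 5.
Proof.
case=> [[wz xz zs] [zv1 zv2 zv3] [vw1 vw2 wv3 vx3] [ws xs] [sv1 vs2 vs3]].
have neq_between (a b c : G) : arc a c -> arc c b -> a != b.
  by move=> ac; apply: contraTneq => <-; rewrite (arc_asym ac).
apply: transitive5_of_seq7 => //.
have wx : w != x by apply: neq_between vx3.
have xv1 : x != v1 by apply: neq_between zv1.
have xv2 : x != v2 by apply: neq_between zv2.
have v12 : v1 != v2 by rewrite eq_sym; apply: neq_between sv1.
have v13 : v1 != v3 by rewrite eq_sym; apply: neq_between sv1.
have v23 : v2 != v3 by apply: neq_between wv3.
rewrite /= !inE !negb_or wx xv1 xv2 v12 v13 v23.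
rewrite [z == w]eq_sym [z == x]eq_sym [w == v1]eq_sym [w == v2]eq_sym.
by rewrite [x == v3]eq_sym [v1 == s]eq_sym !arc_neq.
Qed.

(** A transitive 5-subset omits two of the seven vertices, and these would have to meet every cycle
    listed. If [z] is omitted, no single vertex meets the rest; if [w] but not [z], the same holds;
    otherwise [v1] and [v2] are forced, and [{z, v3, x}] is missed. The next two exclusions follow
    the same scheme. *)
Lemma split_pattern_arc21 (z w x v1 v2 v3 s : G) :
  split_pattern z w x v1 v2 v3 s -> arc x v2 -> arc v1 v2 -> False.
Proof.
move=> /[dup] pat [[wz xz zs] [zv1 zv2 zv3] [vw1 vw2 wv3 vx3] [ws xs] [sv1 vs2 vs3]].
move=> xv2 v12; have [X tX] := split_pattern_transitive5 pat.
have := transitive_on_no3cycle tX zv1 vw1 wz.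
have := transitive_on_no3cycle tX zv2 vw2 wz.
have := transitive_on_no3cycle tX zv3 vx3 xz.
have := transitive_on_no3cycle tX ws sv1 vw1.
have := transitive_on_no3cycle tX sv1 v12 vs2.
have := transitive_on_no4cycle tX vw2 wv3 vx3 xv2.
rewrite /=; case: (z \in X); case: (w \in X); case: (x \in X); case: (v1 \in X);
by case: (v2 \in X); case: (v3 \in X); case: (s \in X).
Qed.

Lemma split_pattern_arc31 (z w x v1 v2 v3 s : G) :
  split_pattern z w x v1 v2 v3 s -> arc x v2 -> arc v1 x -> arc v1 v3 -> False.
Proof.
move=> /[dup] pat [[wz xz zs] [zv1 zv2 zv3] [vw1 vw2 wv3 vx3] [ws xs] [sv1 vs2 vs3]].
move=> xv2 vx1 v13; have [X tX] := split_pattern_transitive5 pat.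
have := transitive_on_no3cycle tX zv1 vw1 wz.
have := transitive_on_no3cycle tX zv2 vw2 wz.
have := transitive_on_no3cycle tX zv3 vx3 xz.
have := transitive_on_no3cycle tX ws sv1 vw1.
have := transitive_on_no3cycle tX xs sv1 vx1.
have := transitive_on_no3cycle tX v13 vs3 sv1.
have := transitive_on_no4cycle tX vw2 wv3 vx3 xv2.
rewrite /=; case: (z \in X); case: (w \in X); case: (x \in X); case: (v1 \in X);
by case: (v2 \in X); case: (v3 \in X); case: (s \in X).
Qed.

Lemma split_pattern_arc23 (z w x v1 v2 v3 s : G) :
  split_pattern z w x v1 v2 v3 s -> arc v1 v2 -> arc v3 v2 -> False.
Proof.
move=> /[dup] pat [[wz xz zs] [zv1 zv2 zv3] [vw1 vw2 wv3 vx3] [ws xs] [sv1 vs2 vs3]].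
move=> v12 v32; have [X tX] := split_pattern_transitive5 pat.
have := transitive_on_no3cycle tX zv1 vw1 wz.
have := transitive_on_no3cycle tX zv2 vw2 wz.
have := transitive_on_no3cycle tX zv3 vx3 xz.
have := transitive_on_no3cycle tX ws sv1 vw1.
have := transitive_on_no3cycle tX sv1 v12 vs2.
have := transitive_on_no3cycle tX wv3 v32 vw2.
rewrite /=; case: (z \in X); case: (w \in X); case: (x \in X); case: (v1 \in X);
by case: (v2 \in X); case: (v3 \in X); case: (s \in X).
Qed.

(** The exclusions orient the open pairs in turn: [v2 -> v1], then [v1 -> x] with the roles of 1 and
    2 exchanged, then [v3 -> v1]; the last exclusion, exchanged again, rules this out. *)
Lemma no_split_out_neighbours_asym (z w x v1 v2 v3 s1 s2 : G) :
  split_pattern z w x v1 v2 v3 s1 -> split_pattern z w x v2 v1 v3 s2 ->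
  arc x v2 -> False.
Proof.
move=> pat1 pat2 xv2.
have [_ [zv1 zv2 zv3] _ _ [sv1 vs2 vs3]] := pat1.
have neq_through (a b : G) : arc a s1 -> arc s1 b -> b != a.
  by move=> as1; apply: contraTneq => ->; rewrite (arc_asym as1).
have v12 : v1 != v2 by apply: neq_through.
have v21 : arc v2 v1 by apply: arcNarc => //; apply/negP/(split_pattern_arc21 pat1).
have vx1 : arc v1 x.
  have [[_ xz _] _ _ _ _] := pat1.
  apply: arcNarc; first by apply: contraTneq zv1 => <-; rewrite (arc_asym xz).
  by apply/negP => xv1; apply: split_pattern_arc21 pat2 xv1 v21.
have v31 : arc v3 v1.
  apply: arcNarc; first exact: neq_through.
  by apply/negP; apply: split_pattern_arc31 pat1 xv2 vx1.
exact: split_pattern_arc23 pat2 v21 v31.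
Qed.

(** If [v3 -> w], or if both [v1 -> x] and [v2 -> x], there is a common out-neighbour. Otherwise
    [w -> v3] and [x] dominates [v1] or [v2], the asymmetric case up to exchanging 1 and 2. *)
Lemma no_split_out_neighbours (z w x v1 v2 v3 s1 s2 s3 : G) :
  private_pattern v1 v2 v3 s1 s2 s3 ->
  arc w z -> arc x z -> (forall v, v \in [:: v1; v2; v3; s1; s2; s3] -> arc z v) ->
  (forall s, s \in [:: s1; s2; s3] -> arc w s /\ arc x s) ->
  arc v1 w -> arc v2 w -> arc v3 x -> False.
Proof.
move=> pat wz xz zvs wxs vw1 vw2 vx3.
have [[sv1 sv2 sv3] [vs12 vs13] [vs21 vs23] [vs31 vs32]] := pat.
have [[ws1 xs1] [ws2 xs2] [ws3 xs3]] :
    [/\ arc w s1 /\ arc x s1, arc w s2 /\ arc x s2 & arc w s3 /\ arc x s3].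
  by split; apply: wxs; rewrite !inE eqxx ?orbT.
have [zv1 zv2 zv3] : [/\ arc z v1, arc z v2 & arc z v3].
  by split; apply: zvs; rewrite !inE eqxx ?orbT.
have [zs1 zs2] : arc z s1 /\ arc z s2 by split; apply: zvs; rewrite !inE eqxx ?orbT.
have neq_z (a b : G) : arc a z -> arc z b -> b != a.
  by move=> az; apply: contraTneq => ->; rewrite (arc_asym az).
have [vw3 | vw3] := boolP (arc v3 w).
  exact: (no_common_out_neighbour pat vw1 vw2 vw3).
have wv3 : arc w v3 by apply: arcNarc vw3; apply: neq_z.
have pat1 : split_pattern z w x v1 v2 v3 s1 by [].
have pat2 : split_pattern z w x v2 v1 v3 s2 by [].
have [vx1 | vx1] := boolP (arc v1 x); last first.
  by apply: (no_split_out_neighbours_asym pat2 pat1); apply: arcNarc vx1; apply: neq_z.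
have [vx2 | vx2] := boolP (arc v2 x); last first.
  by apply: (no_split_out_neighbours_asym pat1 pat2); apply: arcNarc vx2; apply: neq_z.
exact: (no_common_out_neighbour pat vx1 vx2 vx3).
Qed.

End FiniteConfigurations.

(** * 2-in-domination from the excluded configurations *)

Lemma private_patternC12 (G : tournament) (v1 v2 v3 s1 s2 s3 : G) :
  private_pattern v1 v2 v3 s1 s2 s3 -> private_pattern v2 v1 v3 s2 s1 s3.
Proof. by case=> -[? ? ?] [? ?] [? ?] [? ?]. Qed.

Lemma private_patternC23 (G : tournament) (v1 v2 v3 s1 s2 s3 : G) :
  private_pattern v1 v2 v3 s1 s2 s3 -> private_pattern v1 v3 v2 s1 s3 s2.
Proof. by case=> -[? ? ?] [? ?] [? ?] [? ?]. Qed.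

(** Serves for the second and third layers in (a), and in the reversed tournament for the out- and
    in-neighbourhoods of [z] in (c). *)
Lemma two_in_dominates_common (G : tournament) (Z S : {set G}) (z : G) :
  trans_dense 7 5 G -> (forall v, v \in Z -> arc v z) ->
  (forall s, s \in S -> arc z s) -> in_dominates Z S -> two_in_dominates Z S.
Proof.
move=> dense Zz zS dom.
have dis : [disjoint Z & S].
  apply/pred0P => v; apply/negP => /= /andP[/Zz vz /zS].
  by rewrite (arc_asym vz).
have [// | [v1 [v2 [v3 [s1 [s2 [s3 [[v1Z v2Z v3Z] [s1S s2S s3S] pat]]]]]]]] :=
  two_in_dominates_or_private dis dom.
by case: (no_common_out_neighbour dense (w := z) pat); auto.
Qed.

Lemma two_in_dominates_split (G : tournament) (W Z S : {set G}) (z : G) :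
  trans_dense 7 5 G -> (forall w, w \in W -> arc w z) ->
  (forall v, v \in Z :|: S -> arc z v) ->
  (forall w s, w \in W -> s \in S -> arc w s) -> [disjoint Z & S] ->
  two_in_dominates W Z -> in_dominates Z S -> two_in_dominates Z S.
Proof.
move=> dense Wz zZS WS dis domW dom.
have [// | [v1 [v2 [v3 [s1 [s2 [s3 [[v1Z v2Z v3Z] [s1S s2S s3S] pat]]]]]]]] :=
  two_in_dominates_or_private dis dom.
have [w [x [wW xW wx]]] := two_in_dominatesP v1Z domW; exfalso.
have ZS v : v \in [:: v1; v2; v3; s1; s2; s3] -> arc z v.
  by rewrite !inE => in_v; apply: zZS; rewrite inE; case/or4P: in_v => [||| /or3P[]]
    /eqP->; apply/orP; auto.
have inS s : s \in [:: s1; s2; s3] -> s \in S.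
  by rewrite !inE => /or3P[] /eqP->.
(* Stated for any reindexing of the private pattern, with [a] and [b] possibly equal. *)
have absurd (a b : G) u1 u2 u3 t1 t2 t3 : a \in W -> b \in W ->
    private_pattern u1 u2 u3 t1 t2 t3 ->
    {subset [:: u1; u2; u3; t1; t2; t3] <= [:: v1; v2; v3; s1; s2; s3]} ->
    {subset [:: t1; t2; t3] <= [:: s1; s2; s3]} ->
    arc u1 a -> arc u2 a -> arc u3 b -> False.
  move=> aW bW pat' sub subs; apply: (no_split_out_neighbours dense pat') (Wz _ aW)
    (Wz _ bW) _ _.
    by move=> v /sub; apply: ZS.
  by move=> s /subs/inS sS; split; apply: WS.
have sub132 : {subset [:: v1; v3; v2; s1; s3; s2] <= [:: v1; v2; v3; s1; s2; s3]}.
  by apply/allP; rewrite /= !inE !eqxx !orbT.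
have sub231 : {subset [:: v2; v3; v1; s2; s3; s1] <= [:: v1; v2; v3; s1; s2; s3]}.
  by apply/allP; rewrite /= !inE !eqxx !orbT.
have subs132 : {subset [:: s1; s3; s2] <= [:: s1; s2; s3]}.
  by apply/allP; rewrite /= !inE !eqxx !orbT.
have subs231 : {subset [:: s2; s3; s1] <= [:: s1; s2; s3]}.
  by apply/allP; rewrite /= !inE !eqxx !orbT.
have pat132 := private_patternC23 pat.
have pat231 := private_patternC23 (private_patternC12 pat).
have h12 a b aW bW := absurd a b v1 v2 v3 s1 s2 s3 aW bW pat (fun _ => id) (fun _ => id).
have h13 a b aW bW := absurd a b v1 v3 v2 s1 s3 s2 aW bW pat132 sub132 subs132.
have h23 a b aW bW := absurd a b v2 v3 v1 s2 s3 s1 aW bW pat231 sub231 subs231.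
(* By pigeonhole two of the three [v_i] share an out-neighbour among [w] and [x]; that pair selects
   the reindexing. *)
have [vw1 | vx1] := orP (wx v1 v1Z); have [vw2 | vx2] := orP (wx v2 v2Z);
have [vw3 | vx3] := orP (wx v3 v3Z).
- exact: (h12 w w).
- exact: (h12 w x).
- exact: (h13 w x).
- exact: (h23 x w).
- exact: (h23 w x).
- exact: (h13 x w).
- exact: (h12 x w).
- exact: (h12 x x).
Qed.

(** * Distance layers and their arcs *)

Section Layers.
Variables (G : tournament) (z : G).

Lemma has_dipath0 v : has_dipath v z 0 = (v == z).
Proof.
apply/existsP/idP => [[p] | vz]; first by rewrite tuple0 /= andbT.
by exists [tuple]; rewrite /= vz.
Qed.

Lemma has_dipath1 v : has_dipath v z 1 = arc v z.
Proof.
apply/existsP/idP => [[p] | vz].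
  by case/tupleP: p => x p; rewrite tuple0 /= andbT => /and3P[vx /eqP <-].
by exists [tuple z]; rewrite /= vz eqxx inE arc_neq.
Qed.

Lemma has_dipath2 v :
  has_dipath v z 2 = (v != z) && [exists w, arc v w && arc w z].
Proof.
apply/existsP/andP => [[p] | [vz /existsP[w /andP[vw wz]]]].
  case/tupleP: p => w; case/tupleP=> y p; rewrite tuple0 /= !inE negb_or !andbT.
  case/and3P=> /andP[vw wy] /eqP <- /andP[/andP[_ ->] _]; split=> //.
  by apply/existsP; exists w; rewrite vw.
by exists [tuple w; z]; rewrite /= !inE vw wz eqxx negb_or vz !arc_neq.
Qed.

Lemma layer2E : layer 2 z = [set v | arc v z].
Proof.
apply/setP => v; rewrite !inE has_dipath1 andb_idr // => vz.
by apply/forallP => m; rewrite ord1 has_dipath0 arc_neq.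
Qed.

Lemma layer3P v : reflect
  [/\ v != z, ~~ arc v z & exists2 w, arc v w & arc w z] (v \in layer 3 z).
Proof.
rewrite inE has_dipath2 /=; apply: (iffP andP).
  case=> /andP[vz /existsP[w /andP[vw wz]]] /forallP/(_ (Ordinal (isT : 1 < 2))).
  by rewrite has_dipath1; split=> //; exists w.
case=> vz Nvz [w vw wz]; split; first by rewrite vz; apply/existsP; exists w; rewrite vw.
by apply/forallP => -[[|[|]] //= _]; rewrite (has_dipath0, has_dipath1).
Qed.

Lemma layer4W v : v \in layer 4 z ->
  [/\ arc z v, (forall w, arc w z -> arc w v) & exists2 u, u \in layer 3 z & arc v u].
Proof.
rewrite inE => /andP[/existsP[p pP] /forallP min].
have vz : v != z by have := min (Ordinal (isT : 0 < 3)); rewrite has_dipath0.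
have Nvz : ~~ arc v z by have := min (Ordinal (isT : 1 < 3)); rewrite has_dipath1.
have Nv2 w : arc v w -> ~~ arc w z.
  have := min (Ordinal (isT : 2 < 3)); rewrite has_dipath2 vz /=.
  by rewrite negb_exists => /forallP/(_ w); case: arc.
split; first exact: arcNarc.
  move=> w wz; apply: arcNarc; last by apply/negP => /Nv2; rewrite wz.
  by apply: contraNneq Nvz => ->.
(* The second vertex [u] of the path is at distance exactly two: it reaches [z] through [w], differs
   from [z] as the path is simple, and [u -> z] would give [v] a path of length two. *)
move: pP; case/tupleP: p => u; case/tupleP=> w; case/tupleP=> y p.
rewrite tuple0 /= !inE !negb_or !andbT => /and3P[/and3P[vu uw wy] /eqP yz].
rewrite yz in wy * => /and3P[_ /andP[_ uz] _]; exists u => //.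
by apply/layer3P; split; [| exact: Nv2 | exists w].
Qed.

Lemma arc_layer3 v : v \in layer 3 z -> arc z v.
Proof. by case/layer3P=> vz Nvz _; apply: arcNarc. Qed.

Lemma layer2_dominates_layer3 : in_dominates (layer 2 z) (layer 3 z).
Proof. by move=> v /layer3P[_ _ [w vw wz]]; exists w; rewrite // layer2E inE. Qed.

Lemma layer3_dominates_layer4 : in_dominates (layer 3 z) (layer 4 z).
Proof. by move=> v /layer4W[_ _ [u uL vu]]; exists u. Qed.

Lemma disjoint_layer34 : [disjoint layer 3 z & layer 4 z].
Proof.
apply/pred0P => v; apply/negP => /= /andP[/layer3P[_ _ [w vw wz]]].
by case/layer4W=> _ /(_ w wz); rewrite (arc_asym vw).
Qed.

(* The d - 1 vertices of N^-(z) other than v cannot contain N^-(v). *)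
Lemma min_in_degree_out_dominated v :
  (forall u : G, in_degree z <= in_degree u) -> arc v z ->
  exists2 u, arc z u & arc u v.
Proof.
move=> min vz; apply/exists_inP; apply: contraT.
rewrite negb_exists_in => /forall_inP no.
have : [set u | arc u v] \proper [set u | arc u z].
  apply/properP; split; last by exists v; rewrite !inE ?arc_irr.
  apply/subsetP => u; rewrite !inE => uv; apply: arcNarc.
    by apply: contraTneq uv => <-; rewrite (arc_asym vz).
  by apply: contraL uv; apply: no.
by move/proper_card; rewrite ltnNge min.
Qed.

End Layers.

(** * Assembly of the three statements *)

Theorem theorem4 (T' : tournament) (hT' : T7_free T') (z : T') :
  (T5_free (induced (layer 3 z)) /\ two_in_dominates (layer 2 z) (layer 3 z)) /\
  (T5_free (induced (layer 4 z)) /\ two_in_dominates (layer 3 z) (layer 4 z)) /\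
  ((forall v : T', in_degree z <= in_degree v) ->
     T5_free (induced (layer 2 z))).
Proof.
have dense : trans_dense 7 5 T' by apply/family_freeP.
have L2 w : w \in layer 2 z -> arc w z by rewrite layer2E inE.
have dom3 : two_in_dominates (layer 2 z) (layer 3 z).
  apply: (two_in_dominates_common dense L2); first exact: arc_layer3.
  exact: layer2_dominates_layer3.
have dom4 : two_in_dominates (layer 3 z) (layer 4 z).
  apply: (two_in_dominates_split dense L2 _ _ _ dom3).
  - by move=> v; rewrite inE => /orP[/arc_layer3 | /layer4W[]].
  - by move=> w s /L2 wz /layer4W[_ /(_ w wz)].
  - exact: disjoint_layer34.
  - exact: layer3_dominates_layer4.
split; [split=> // | split; [split=> // | move=> min]];
  apply/family_freeP; apply: trans_dense_induced.
- apply: (two_in_dominated_T5_free dense dom3) => v vz; exists z; first exact: L2.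
  exact: arc_layer3.
(* Any out-neighbour [w] of [v] in the second layer works, since it dominates the whole fourth
   layer. *)
- apply: (two_in_dominated_T5_free dense dom4) => v /layer3P[_ _ [w vw wz]].
  by exists w => // s /layer4W[_ /(_ w wz)].
move=> S sS cS; rewrite -has_transitive_subset_reverse.
have denseR := trans_dense_reverse dense.
pose N : {set reverse T'} := [set u : T' | arc z u].
(* After reversal, every vertex of [N] has an arc to [z], and [z] to every vertex of the second
   layer, as in (a). *)
have domR : @two_in_dominates (reverse T') N (layer 2 z).
  apply: (@two_in_dominates_common (reverse T') N _ z denseR); rewrite /= /rev_arc.
  - by move=> u; rewrite inE.
  - exact: L2.
  - move=> v /L2 vz; have [u zu uv] := min_in_degree_out_dominated min vz.
    by exists u; rewrite // inE.
apply: (two_in_dominated_T5_free denseR domR _ sS cS) => v; rewrite inE => zv.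
by exists z => // s /L2.
Qed.
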